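(* Let $L\subset\mathbb{R}^n$ be an integral lattice of minimum squared norm $\mu$, and suppose its minimal shell $X=\{x\in L:\|x\|^2=\mu\}$ has $N$ points and is a spherical $(2s+1)$-design. Choose linearly independent $b_1,\dots,b_r\in L$ with Gram matrix $H$. For $x\in X$ set $y(x)=(\langle x,b_i\rangle)_{i=1}^r$, and for $y\in\mathbb{R}^r$ set $q(y)=y^tH^{-1}y$ and $f(y)=|\{x\in X:y(x)=y\}|$. Choose a finite antipodal set $\mathcal{R}\subset\mathbb{Z}^r\setminus\{0\}$ and put $$E=\{Hz:z\in\mathcal{R},\ z^tHz=\mu\},\qquad D=\{y\in\mathbb{Z}^r:q(y)\le\mu,\ |z^ty|\le z^tHz/2\text{ for every }z\in\mathcal{R}\}.$$ Then $D$ and $E$ are disjoint, every signature $y(x)$ ($x\in X$) lies in $D\cup E$, and $f(e)=1$ for each $e\in E$. For a multi-index $\alpha\in\mathbb{Z}_{\ge0}^r$ of total degree $|\alpha|\le2s+1$, define $M_\alpha=0$ when $|\alpha|$ is odd, and, when $|\alpha|=2m$, $$M_\alpha=\frac{N\mu^m}{\prod_{j=0}^{m-1}(n+2j)}\sum_P\prod_{(a,b)\in P}H_{i_ai_b},$$ where the labelled list $(i_1,\dots,i_{2m})$ contains $\alpha_i$ copies of each $i$, and $P$ runs over the pairings (perfect matchings) of $\{1,\dots,2m\}$; empty products are $1$, so $M_0=N$. Let $\Gamma$ be a finite group of linear transformations of $\mathbb{R}^r$ preserving $q$, $D$ and $E$, and let $\psi:D\cup E\to\mathbb{R}$ be $\Gamma$-invariant.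 Let $O_j$ be the $\Gamma$-orbits on $D$. For $\alpha$ in any selected set of multi-indices of total degree at most $2s+1$, form $$A_{\alpha j}=\sum_{y\in O_j}y^\alpha,\qquad b_\alpha=M_\alpha-\sum_{e\in E}e^\alpha,\qquad c_j=\sum_{y\in O_j}\psi(y).$$ If a real vector $\lambda$ (indexed by the selected multi-indices) satisfies $A^t\lambda\le c$ entrywise, then $$\sum_{x\in X}\psi(y(x))\ \ge\ \sum_{e\in E}\psi(e)+\lambda^tb .$$ If $A^t\lambda=c$, equality holds. (The sublattice spanned by the $b_i$ is not required to be primitive.)
   Context: A lattice is integral if all inner products of its vectors are integers. A finite subset $X$ of the sphere of radius $\sqrt\mu$ in $\mathbb{R}^n$ is a spherical $T$-design if the average over $X$ of every polynomial of degree at most $T$ equals its average over the sphere. Antipodal means closed under $z\mapsto-z$. For $y\in\mathbb{R}^r$, $y^\alpha=\prod_iy_i^{\alpha_i}$. *)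

(* Defs.v *)
From HB Require Import structures.
From mathcomp Require Import all_boot all_order all_algebra.
From mathcomp Require Import finmap.
From mathcomp Require Import all_classical all_reals all_analysis.
(* The notations of mpoly clash with those of MathComp-Analysis. *)
From mathcomp Require Import -(notations) mpoly.

Set Implicit Arguments.
Unset Strict Implicit.
Unset Printing Implicit Defensive.

Import Order.TTheory GRing.Theory Num.Theory.
Import numFieldNormedType.Exports.

Local Open Scope classical_set_scope.
Local Open Scope ring_scope.


(* Points of the ambient R^n are row vectors; vectors of R^r (signatures,
   coefficient vectors) are column vectors. *)

Section Lattices.
Variables (R : realType) (n : nat).
Implicit Types (L : set 'rV[R]_n) (u v x : 'rV[R]_n) (mu : R).

Definition dotp u v : R := (u *m v^T) 0 0.

Definition sqnorm u : R := dotp u u.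

(* The rank k is not required to be n. *)
Definition is_lattice L : Prop :=
  exists k (B : 'M[R]_(k, n)),
    row_free B /\ L = [set map_mx intr z *m B | z in [set: 'rV[int]_k]].

Definition integral_lattice L : Prop :=
  is_lattice L /\ forall u v, L u -> L v -> dotp u v \is a Num.int.

Definition min_sqnorm L mu : Prop :=
  (exists2 v, L v & v != 0 /\ sqnorm v = mu) /\
  (forall v, L v -> v != 0 -> mu <= sqnorm v).

Definition shell L mu : set 'rV[R]_n := [set x | L x /\ sqnorm x = mu].

End Lattices.

Section SphericalDesigns.
Variables (R : realType) (n : nat).

(* R^n with its Borel sigma-algebra. *)
Definition borel_rV := g_sigma_algebraType (@open 'rV[R]_n).

Definition sphere (mu : R) : set 'rV[R]_n := [set x | sqnorm x = mu].

(* The normalized surface measure of the sphere of squared radius mu, given as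
   the (unique) Borel probability measure carried by the sphere and invariant
   under the orthogonal group. *)
Definition uniform_on_sphere (mu : R) (sigma : probability borel_rV R) : Prop :=
  sigma (sphere mu) = 1%E /\
  forall Q : 'M[R]_n, Q *m Q^T = 1%:M ->
  forall A : set borel_rV, measurable A ->
    sigma ((fun x : 'rV[R]_n => x *m Q) @^-1` A) = sigma A.

Definition polyval (p : mpoly n R) (x : 'rV[R]_n) : R :=
  meval (fun i => x 0 i) p.

(* msize p is one more than the total degree of p (and 0 for p = 0). *)
Definition spherical_design (T : nat) (mu : R) (X : set 'rV[R]_n) : Prop :=
  [/\ finite_set X, X `<=` sphere mu &
      exists2 sigma, uniform_on_sphere mu sigma &
        forall p : mpoly n R, (msize p <= T.+1)%N ->
          (\sum_(x \in X) polyval p x) / (#|` fset_set X|)%:R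
          = \int[sigma]_(x in sphere mu) polyval p x].

End SphericalDesigns.

Section Signatures.
Variables (R : realType) (n r : nat).

(* The b_i are the rows of B. *)
Definition gram (B : 'M[R]_(r, n)) : 'M[R]_r :=
  \matrix_(i, j) dotp (row i B) (row j B).

Definition signature (B : 'M[R]_(r, n)) (x : 'rV[R]_n) : 'cV[R]_r :=
  \col_i dotp x (row i B).

Definition signature_count (X : set 'rV[R]_n) (B : 'M[R]_(r, n))
    (y : 'cV[R]_r) : nat :=
  #|` fset_set [set x | X x /\ signature B x = y]|.

Definition qform (M : 'M[R]_r) (y : 'cV[R]_r) : R := (y^T *m M *m y) 0 0.

Definition int_vec (z : 'cV[int]_r) : 'cV[R]_r := map_mx intr z.

Definition antipodal (V : zmodType) (A : set V) : Prop :=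
  forall z, A z -> A (- z).

Definition sig_E (H : 'M[R]_r) (mu : R) (Z : set 'cV[int]_r) : set 'cV[R]_r :=
  [set H *m int_vec z | z in [set z | Z z /\ qform H (int_vec z) = mu]].

Definition sig_D (H : 'M[R]_r) (mu : R) (Z : set 'cV[int]_r) : set 'cV[R]_r :=
  [set y | [/\ exists w, y = int_vec w,
               qform (invmx H) y <= mu &
               forall z, Z z ->
                 `|((int_vec z)^T *m y) 0 0| <= qform H (int_vec z) / 2]].

End Signatures.

Section Moments.
Variables (R : realType) (r : nat).

Definition monomial (alpha : multinom r) (y : 'cV[R]_r) : R :=
  \prod_(i < r) y i 0 ^+ alpha i.

Definition perfect_matching (k : nat) (P : {set {set 'I_k}}) : bool :=
  finset.partition P [set: 'I_k]%SET && [forall A in P, #|A| == 2%N].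

(* Each pair {a, b} of P contributes one factor, indexed by (a, b) with a < b. *)
Definition pairing_sum (H : 'M[R]_r) (l : seq 'I_r) : R :=
  \sum_(P : {set {set 'I_(size l)}} | perfect_matching P)
    \prod_(ab : 'I_(size l) * 'I_(size l)
           | (ab.1 < ab.2)%N && ([set ab.1; ab.2]%SET \in P))
      H (tnth (in_tuple l) ab.1) (tnth (in_tuple l) ab.2).

(* m2s alpha is the list with alpha i copies of each i. *)
Definition moment (n N : nat) (mu : R) (H : 'M[R]_r) (alpha : multinom r) : R :=
  let m := (mdeg alpha)./2 in
  if odd (mdeg alpha) then 0
  else N%:R * mu ^+ m / (\prod_(j < m) (n + 2 * j)%:R)
       * pairing_sum H (m2s alpha).

End Moments.

Section Symmetry.
Variables (R : realType) (r : nat).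

(* A finite group of linear maps y |-> g *m y. *)
Definition finite_linear_group (G : set 'M[R]_r) : Prop :=
  [/\ finite_set G,
      G 1%:M,
      forall g h, G g -> G h -> G (g *m h) &
      forall g, G g -> g \in unitmx /\ G (invmx g)].

Definition preserves_form (G : set 'M[R]_r) (q : 'cV[R]_r -> R) : Prop :=
  forall g, G g -> forall y, q (g *m y) = q y.

Definition preserves_set (G : set 'M[R]_r) (A : set 'cV[R]_r) : Prop :=
  forall g, G g -> [set g *m y | y in A] = A.

Definition invariant_on (G : set 'M[R]_r) (A : set 'cV[R]_r)
    (psi : 'cV[R]_r -> R) : Prop :=
  forall g y, G g -> A y -> psi (g *m y) = psi y.

Definition orbits (G : set 'M[R]_r) (A : set 'cV[R]_r) : set (set 'cV[R]_r) :=
  [set [set g *m y | g in G] | y in A].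

End Symmetry.

(* Main.v *)
(* The design property turns every sum over X of a product of at most 2s+1
   linear forms into an orthogonally invariant symmetric form.  Differentiating
   this invariance along plane rotations yields the Wick recursion, hence the
   moments M_alpha.  They depend on the b_i only through their Gram matrix, so
   replacing the signatures y(x) by g y(x), g in Gamma, leaves them unchanged.
   As f need not be constant on orbits, one averages over Gamma: this turns the
   dual inequality on an orbit into one at each signature in D.  The vectors of
   X with signature in E are exactly the combinations of the b_i with a
   coefficient vector in the given antipodal set; for any other x in X,
   minimality of mu applied to the differences of x with the combinations given
   by the antipodal set puts y(x) in D. *)
Require Import Defs.
From mathcomp Require Import all_boot all_order all_algebra.
From mathcomp Require Import finmap.
From mathcomp Require Import all_classical all_reals all_analysis.
From mathcomp Require Import measurable_realfun.
From mathcomp Require Import zify ring lra.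
From mathcomp Require Import -(notations) mpoly.

Set Implicit Arguments.
Unset Strict Implicit.
Unset Printing Implicit Defensive.

Import Order.TTheory GRing.Theory Num.Theory.
Import numFieldNormedType.Exports.

Local Open Scope classical_set_scope.
Local Open Scope ring_scope.

(** * Rotation invariance of sums of products of linear forms over a design *)

Section OrthogonalInvariance.
Variables (R : realType) (n : nat).
Implicit Types (u v x : 'rV[R]_n) (X : set 'rV[R]_n).

Lemma dotpE u v : dotp u v = \sum_i u 0 i * v 0 i.
Proof. by rewrite /dotp mxE; apply: eq_bigr => i _; rewrite mxE. Qed.

Lemma dotp_mull m (w : 'rV[R]_m) (Q : 'M[R]_(m, n)) v :
  dotp (w *m Q) v = dotp w (v *m Q^T).
Proof. by rewrite /dotp trmx_mul trmxK mulmxA. Qed.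

Lemma sqnorm_orthogonal (Q : 'M[R]_n) x :
  Q *m Q^T = 1%:M -> sqnorm (x *m Q) = sqnorm x.
Proof. by move=> QQ; rewrite /sqnorm dotp_mull -mulmxA QQ mulmx1. Qed.

Lemma continuous_row_borel_measurable (f : 'rV[R]_n -> R) :
  continuous f -> measurable_fun setT (f : borel_rV R n -> R).
Proof.
move=> /continuousP cf; apply: (measurability _ (RGenOpens.measurableE R)).
move=> _ [_ [a [b ->] <-]]; rewrite setTI; apply: sub_sigma_algebra.
exact/cf/interval_open.
Qed.

Lemma dotp_continuous v : continuous (fun x : 'rV[R]_n => dotp x v).
Proof.
rewrite (_ : (fun x => _) = fun x : 'rV[R]_n => \sum_i x 0 i * v 0 i);
  last by apply/funext => x; rewrite dotpE.
apply: continuous_big; first exact: add_continuous.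
move=> i _ x; apply: (cvgM (@coord_continuous R 1 n 0 i x)).
exact: cvg_cst.
Qed.

Lemma mulmx_row_continuous (Q : 'M[R]_n) :
  continuous (fun x : 'rV[R]_n => x *m Q).
Proof.
move=> x A /= /nbhs_ballP[e e0 eA].
suff : \forall y \near x, forall j, ball ((x *m Q) 0 j) e ((y *m Q) 0 j).
  apply: filterS => y xy; apply: eA; split => // i j; rewrite ord1; exact: xy.
apply: (@filter_forall _ _ _ _ (nbhs_filter x)) => j.
have cj : {for x, continuous (fun y : 'rV[R]_n => (y *m Q) 0 j)}.
  rewrite (_ : (fun y => _) = (fun y : 'rV[R]_n => dotp y (col j Q)^T)).
    exact: dotp_continuous.
  by apply/funext => y; rewrite dotpE mxE; apply: eq_bigr => i _; rewrite !mxE.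
exact: (cj _ (nbhsx_ballx _ _ e0)).
Qed.

Lemma mulmx_row_borel_measurable (Q : 'M[R]_n) :
  measurable_fun setT
    ((fun x : 'rV[R]_n => x *m Q) : borel_rV R n -> borel_rV R n).
Proof.
apply: (@measurability _ _ (borel_rV R n) (borel_rV R n) setT _
  (@open 'rV[R]_n)) => //.
move=> _ [A oA <-]; rewrite setTI; apply: sub_sigma_algebra.
have /continuousP := @mulmx_row_continuous Q; exact.
Qed.

Lemma measurable_sphere (mu : R) :
  measurable (sphere mu : set (borel_rV R n)).
Proof.
have m_sq : measurable_fun setT
    ((fun x : 'rV[R]_n => sqnorm x) : borel_rV R n -> R).
  apply: continuous_row_borel_measurable.
  rewrite (_ : (fun x => _) = fun x : 'rV[R]_n => \sum_i x 0 i * x 0 i).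
    apply: continuous_big; first exact: add_continuous.
    by move=> i _ x; apply: (cvgM (@coord_continuous R 1 n 0 i x));
      exact: coord_continuous.
  by apply/funext => x; rewrite /sqnorm dotpE.
rewrite [X in measurable X](_ : _ = setT `&` (@sqnorm R n) @^-1` [set mu]).
  exact: (m_sq measurableT).
by rewrite setTI.
Qed.

(** The map x -> xQ preserves both the sphere and [sigma], so this is a change of variables. It is
    carried out for nonnegative functions by pushforward, then applied to the positive and negative
    parts of [f]. *)
Lemma Rintegral_sphere_orthogonal (mu : R) (sigma : probability (borel_rV R n) R)
    (Q : 'M[R]_n) (f : 'rV[R]_n -> R) :
  uniform_on_sphere mu sigma -> Q *m Q^T = 1%:M -> continuous f ->
  \int[sigma]_(x in sphere mu) f (x *m Q) = \int[sigma]_(x in sphere mu) f x.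
Proof.
move=> [_ sigmaQ] QQ cf.
pose phi : borel_rV R n -> borel_rV R n := fun x : 'rV[R]_n => x *m Q.
have mphi : measurable_fun setT phi by exact: mulmx_row_borel_measurable.
have phiS : phi @^-1` (sphere mu) = sphere mu.
  by apply/seteqP; split => x; rewrite /phi /sphere /= sqnorm_orthogonal.
pose F : borel_rV R n -> \bar R := EFin \o (f : borel_rV R n -> R).
have mF : measurable_fun (sphere mu : set (borel_rV R n)) F.
  apply/measurable_EFinP; apply: measurable_funTS.
  exact: continuous_row_borel_measurable.
have ge0E (g : borel_rV R n -> \bar R) :
    measurable_fun (sphere mu : set (borel_rV R n)) g ->
    (forall x, 0 <= g x)%E ->
    (\int[sigma]_(x in sphere mu) g (phi x) = \int[sigma]_(x in sphere mu) g x)%E.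
  move=> mg g0; rewrite -[in LHS]phiS.
  rewrite -(@ge0_integral_pushforward _ _ _ _ R phi mphi sigma _ g) //.
  - by apply: eq_measure_integral => A mA _; exact: sigmaQ.
  - exact: measurable_sphere.
rewrite /Rintegral; congr fine.
rewrite [LHS]integralE [RHS]integralE.
rewrite -[in RHS](ge0E F^\+%E) //; last exact: measurable_funepos.
rewrite -[in RHS](ge0E F^\-%E) //; last exact: measurable_funeneg.
by congr (_ - _)%E; apply: eq_integral => x _; rewrite ?funeposE ?funenegE.
Qed.

(** Makes products of linear forms accessible to the design property; the successor is there because
    [msize] is one more than the degree. *)
Lemma polyval_prod_dotp (T : finType) (A : {set T}) (u : T -> 'rV[R]_n) :
  exists2 p : mpoly n R, (msize p <= #|A|.+1)%N &
    forall x, polyval p x = \prod_(a in A) dotp x (u a).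
Proof.
pose ell a : mpoly n R := \sum_i u a 0 i *: mpolyX R (mnm1 i).
exists (\prod_(a in A) ell a)%R; last first.
  move=> x; rewrite /polyval rmorph_prod /=; apply: eq_bigr => a _.
  rewrite dotpE rmorph_sum /=; apply: eq_bigr => i _.
  by rewrite mevalZ mevalXU mulrC.
rewrite -sum1_card.
apply: (big_ind2 (fun (p : mpoly n R) k => (msize p <= k.+1)%N)).
- by rewrite msize1.
- move=> p k q l pk ql.
  have [->|p0] := eqVneq p 0%R; first by rewrite mul0r msize0.
  have [->|q0] := eqVneq q 0%R; first by rewrite mulr0 msize0.
  rewrite msizeM //.
  by rewrite -subn1 leq_subLR add1n -addnS -addSn leq_add.
- move=> a _; apply: leq_trans (mmeasure_sum _ _ _ _) _.
  apply/bigmax_leqP => i _.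
  by rewrite (leq_trans (msizeZ_le _ _)) // msizeX mdeg1.
Qed.

(** After division by the number of points both sides become integrals over the sphere, and moving
    [Q] from the [u a] to [x] turns it into the change of variables by [Q^T]. *)
Lemma spherical_design_orthogonal_invariant T mu X (I : finType) (A : {set I})
    (u : I -> 'rV[R]_n) (Q : 'M[R]_n) :
  spherical_design T mu X -> X !=set0 -> (#|A| <= T)%N -> Q *m Q^T = 1%:M ->
  \sum_(x \in X) \prod_(a in A) dotp x (u a *m Q) =
  \sum_(x \in X) \prod_(a in A) dotp x (u a).
Proof.
move=> [finX _ [sigma Usigma Xsigma]] [x0 Xx0] AT QQ.
have N0 : (#|` fset_set X|)%:R != 0 :> R.
  rewrite pnatr_eq0 cardfs_eq0; apply/negP => /eqP X0.
  have : x0 \in fset_set X by rewrite in_fset_set // inE.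
  by rewrite X0.
have avgE (v : I -> 'rV[R]_n) :
    (\sum_(x \in X) \prod_(a in A) dotp x (v a)) / (#|` fset_set X|)%:R =
    \int[sigma]_(x in sphere mu) \prod_(a in A) dotp x (v a).
  have [p pA pE] := polyval_prod_dotp A v.
  have := Xsigma p; rewrite (leq_trans pA) // => /(_ isT).
  under eq_fsbigr do rewrite pE.
  by move=> ->; apply: eq_Rintegral => x _; exact: pE.
apply: (mulIf (invr_neq0 N0)); rewrite !avgE.
have QTQ : Q^T *m Q = 1%:M by exact: mulmx1C.
rewrite -[RHS](@Rintegral_sphere_orthogonal _ _ Q^T) ?trmxK //.
  apply: eq_Rintegral => x _; apply: eq_bigr => a _.
  by rewrite dotp_mull trmxK.
apply: continuous_big; first exact: mul_continuous.
by move=> a _; exact: dotp_continuous.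
Qed.

End OrthogonalInvariance.

(** * Infinitesimal rotations, by comparison of polynomial coefficients *)

Section RotationDerivative.
Variables (R : realType) (n : nat).

(** The invariance that a design of strength [T] provides. The index set [A] is arbitrary so that
    the recursion can delete indices from it. *)
Definition orthogonally_invariant (T : nat) (xs : seq 'rV[R]_n) : Prop :=
  forall (I : finType) (A : {set I}) (u : I -> 'rV[R]_n) (Q : 'M[R]_n),
    (#|A| <= T)%N -> Q *m Q^T = 1%:M ->
    \sum_(x <- xs) \prod_(a in A) dotp x (u a *m Q) =
    \sum_(x <- xs) \prod_(a in A) dotp x (u a).

Lemma dotpDr (x u v : 'rV[R]_n) : dotp x (u + v) = dotp x u + dotp x v.
Proof. by rewrite /dotp linearD mulmxDr mxE. Qed.

Lemma dotpZr (x u : 'rV[R]_n) c : dotp x (c *: u) = c * dotp x u.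
Proof. by rewrite /dotp linearZ -scalemxAr mxE. Qed.

Lemma dotpC (u v : 'rV[R]_n) : dotp u v = dotp v u.
Proof. by rewrite !dotpE; apply: eq_bigr => i _; rewrite mulrC. Qed.

Lemma horner_eq0_poly (p : {poly R}) : (forall t, p.[t] = 0) -> p = 0.
Proof.
move=> p0; apply: (@roots_geq_poly_eq0 _ _ [seq k%:R | k <- iota 0 (size p)]).
- by apply/allP => t _; apply/rootP.
- rewrite map_inj_uniq ?iota_uniq // => i j /eqP.
  by rewrite eqr_nat => /eqP.
- by rewrite size_map size_iota.
Qed.

(** The Leibniz rule at 0, read off coefficients. *)
Lemma coef1_prod_set (I : finType) (A : {set I}) (F : I -> {poly R}) :
  (\prod_(a in A) F a)`_1 =
  \sum_(a in A) (F a)`_1 * \prod_(b in A :\ a) (F b)`_0.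
Proof.
elim: {A}#|A| {-2}A (erefl #|A|) => [|k IH] A cardA.
  by rewrite (cards0_eq cardA) !big_set0 coef1.
have /card_gt0P[a Aa] : (0 < #|A|)%N by rewrite cardA.
have cardA' : #|A :\ a| = k by move: cardA; rewrite (cardsD1 a) Aa => -[].
rewrite (big_setD1 a) //= coefM big_ord_recl big_ord1 /= [RHS](big_setD1 a) //=.
rewrite addrC coef0_prod IH //; congr (_ + _).
rewrite mulr_sumr; apply: eq_bigr => c; rewrite !inE => /andP[ca Ac].
rewrite mulrCA; congr (_ * _).
have acA : a \in A :\ c by rewrite !inE eq_sym ca.
rewrite [RHS](big_setD1 a) //=; congr (_ * _).
by apply: eq_bigl => b; rewrite !inE andbCA.
Qed.

(** [Q] is the Cayley transform (1 + tJ)(1 - tJ)^-1, reduced by J^3 = -J: on the image of [J] it is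
    (1 - t^2 + 2tJ)/(1 + t^2), on the kernel it is 1. Its entries are polynomials in t over 1 + t^2,
    which lets algebra replace differentiation. *)
Lemma cayley_orthogonal (J : 'M[R]_n) (t : R) :
  J^T = - J -> J *m J *m J = - J ->
  let Q := (1 + t ^+ 2)^-1 *:
    (1%:M + (2 * t) *: J + t ^+ 2 *: (1%:M + 2 *: (J *m J))) in
  Q *m Q^T = 1%:M.
Proof.
move=> JT J3 /=.
have J4 : J *m J *m (J *m J) = - (J *m J) by rewrite mulmxA J3 mulNmx.
have t0 : 1 + t ^+ 2 != 0 :> R by rewrite gt_eqF // ltr_pwDl // sqr_ge0.
have -> : 1%:M + (2 * t) *: J + t ^+ 2 *: (1%:M + 2 *: (J *m J)) =
    (1 + t ^+ 2)%:M + (2 * t) *: J + (2 * t ^+ 2) *: (J *m J).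
  by apply/matrixP => i j; rewrite !mxE; ring.
have MT : ((1 + t ^+ 2)%:M + (2 * t) *: J + (2 * t ^+ 2) *: (J *m J))^T =
    (1 + t ^+ 2)%:M - (2 * t) *: J + (2 * t ^+ 2) *: (J *m J).
  rewrite !linearD /= !linearZ /= tr_scalar_mx trmx_mul JT scalerN.
  by rewrite mulNmx mulmxN opprK.
rewrite linearZ /= MT -scalemxAl -scalemxAr scalerA.
rewrite !(mulmxDl, mulmxDr, mulmxN, mulNmx) -!(scalemxAl, scalemxAr).
rewrite !mul_scalar_mx !mul_mx_scalar [J *m J *m J]J3 J4.
have -> : J *m (J *m J) = - J by rewrite mulmxA.
move: (J *m J) => K; apply/matrixP => i j; rewrite !mxE; field.
by rewrite t0.
Qed.

(* The coefficient of t in the invariance of the design under the Cayley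
   transform of tJ, cleared of its denominator (1 + t^2)^|A|. *)
Lemma sum_skew_derivative T (xs : seq 'rV[R]_n) (I : finType) (A : {set I})
    (u : I -> 'rV[R]_n) (J : 'M[R]_n) :
  orthogonally_invariant T xs -> (#|A| <= T)%N ->
  J^T = - J -> J *m J *m J = - J ->
  \sum_(x <- xs) \sum_(a in A)
    dotp x (u a *m J) * \prod_(b in A :\ a) dotp x (u b) = 0.
Proof.
move=> invX AT JT J3.
pose F x a : {poly R} := (dotp x (u a))%:P + (2 * dotp x (u a *m J)) *: 'X
  + dotp x (u a *m (1%:M + 2 *: (J *m J))) *: 'X^2.
have F_Q x a t : (F x a).[t] = (1 + t ^+ 2) *
    dotp x (u a *m ((1 + t ^+ 2)^-1 *:
      (1%:M + (2 * t) *: J + t ^+ 2 *: (1%:M + 2 *: (J *m J))))).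
  have t0 : 1 + t ^+ 2 != 0 :> R by rewrite gt_eqF // ltr_pwDl // sqr_ge0.
  rewrite -scalemxAr dotpZr mulrA divff // mul1r !mulmxDr -!scalemxAr.
  rewrite mulmx1 !dotpDr !dotpZr /F mulmxDr mulmx1 !dotpDr -scalemxAr !dotpZr.
  by rewrite !hornerE /=; ring.
have /(congr1 (fun p : {poly R} => p`_1)) :
    \sum_(x <- xs) \prod_(a in A) F x a =
    (1 + 'X^2) ^+ #|A| * (\sum_(x <- xs) \prod_(a in A) dotp x (u a))%:P.
  apply/eqP; rewrite -subr_eq0; apply/eqP; apply: horner_eq0_poly => t.
  rewrite !hornerE horner_sum; apply/eqP; rewrite subr_eq0; apply/eqP.
  rewrite -(invX _ _ _ _ AT (cayley_orthogonal t JT J3)) mulr_sumr.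
  apply: eq_bigr => x _; rewrite horner_prod.
  under eq_bigr do rewrite F_Q.
  by rewrite big_split /= prodr_const.
(* The factors 1 + t^2 have no linear term, so the right side contributes nothing at order t. *)
rewrite coefMC -prodr_const coef1_prod_set [in RHS]big1 => [|a _]; last first.
  by rewrite coefD coef1 coefXn addr0 mul0r.
rewrite mul0r coef_sum => F1_0.
(* The Cayley transform is 1 + 2tJ to first order, whence the factor 2. *)
apply: (mulfI (_ : 2 != 0 :> R)); first by rewrite pnatr_eq0.
rewrite mulr0 -[RHS]F1_0 mulr_sumr; apply: eq_bigr => x _.
rewrite coef1_prod_set mulr_sumr; apply: eq_bigr => a _.
rewrite mulrA; congr (_ * _); first by rewrite /F !coefE /=; ring.
by apply: eq_bigr => b _; rewrite /F !coefE /=; ring.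
Qed.
End RotationDerivative.

(** * The recursion for moments of linear forms, and their vanishing in odd degree *)

Section MomentRecursion.
Variables (R : realType) (n : nat).
Implicit Types (x w : 'rV[R]_n).

Lemma dotp_elementary_skew x w i j :
  dotp x (w *m (delta_mx i j - delta_mx j i)) =
  w 0 i * x 0 j - w 0 j * x 0 i.
Proof.
have E k l : dotp x (w *m delta_mx k l) = w 0 k * x 0 l.
  rewrite dotpE (bigD1 l) //= big1 => [|m ml]; last first.
    rewrite mxE big1 ?mulr0 // => k' _.
    by rewrite mxE (negPf ml) andbF mulr0.
  rewrite addr0 mulrC mxE (bigD1 k) //= big1 => [|m mk]; last first.
    by rewrite mxE (negPf mk) mulr0.
  by rewrite mxE !eqxx mulr1 addr0.
by rewrite mulmxBr -scaleN1r dotpDr dotpZr !E mulN1r.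
Qed.

Lemma elementary_skew_tr (i j : 'I_n) :
  (delta_mx i j - delta_mx j i : 'M[R]_n)^T = - (delta_mx i j - delta_mx j i).
Proof. by rewrite linearB /= !trmx_delta opprB. Qed.

(** The matrix is a quarter turn of the (i, j) plane and 0 on its complement. For i = j it is 0, so
    sums over planes may run over all pairs (i, j). *)
Lemma elementary_skew_cube (i j : 'I_n) :
  let J := delta_mx i j - delta_mx j i : 'M[R]_n in J *m J *m J = - J.
Proof.
move=> /=; have [->|ij] := eqVneq i j; first by rewrite subrr !mulmx0 oppr0.
rewrite !(mulmxBl, mulmxBr) !mul_delta_mx_cond !eqxx [j == i]eq_sym (negPf ij).
rewrite !(mulr0n, mulr1n, mulmxBl, mulmxBr, mul0mx, mulmx0, sub0r, subr0).
rewrite !(mulNmx, mul_delta_mx_cond) !eqxx [j == i]eq_sym (negPf ij).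
rewrite !(mulr0n, mulr1n) ?(oppr0, subr0, add0r, addr0) ?opprK.
by rewrite opprB addrC.
Qed.

(** Slot [a] is filled with the basis vector e_j and the product is differentiated along the (i, j)
    plane. Let P be the full product. After the weighted sum, the derivative in slot [a] yields (1 -
    n) P, and the one in slot c yields a contraction of [u a] with [u c] minus P. The |A| - 1 slots
    other than [a] bring the coefficient of P to 2 - n - |A|. *)
Lemma sum_elementary_skew (I : finType) (A : {set I}) (u : I -> 'rV[R]_n) a x :
  a \in A ->
  let v j c := if c == a then delta_mx 0 j else u c in
  \sum_i u a 0 i * \sum_j \sum_(c in A)
    dotp x (v j c *m (delta_mx i j - delta_mx j i)) *
    \prod_(b in A :\ c) dotp x (v j b)
  = (2 - n%:R - #|A|%:R) * \prod_(b in A) dotp x (u b)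
    + sqnorm x * \sum_(c in A :\ a) dotp (u a) (u c) *
                   \prod_(b in A :\ a :\ c) dotp x (u b).
Proof.
move=> Aa v; set P := \prod_(b in A :\ a) dotp x (u b).
pose Pc c := \prod_(b in A :\ a :\ c) dotp x (u b).
have PcE c : c \in A :\ a -> dotp x (u c) * Pc c = P.
  by move=> Ac; rewrite /P (big_setD1 c).
have dotp_delta j : dotp x (delta_mx 0 j) = x 0 j.
  rewrite dotpE (bigD1 j) //= big1 => [|k kj]; last first.
    by rewrite mxE (negPf kj) andbF mulr0.
  by rewrite mxE !eqxx mulr1 addr0.
have inner i j : \sum_(c in A)
    dotp x (v j c *m (delta_mx i j - delta_mx j i)) *
    \prod_(b in A :\ c) dotp x (v j b) =
    ((i == j)%:R * x 0 j - x 0 i) * P +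
    \sum_(c in A :\ a) (u c 0 i * x 0 j - u c 0 j * x 0 i) * (x 0 j * Pc c).
  rewrite (big_setD1 a) //=; congr (_ + _).
    rewrite dotp_elementary_skew /v eqxx !mxE !eqxx /= mul1r.
    rewrite [i == j]eq_sym; congr (_ * _); apply: eq_bigr => b.
    by rewrite !inE => /andP[/negPf ->].
  apply: eq_bigr => c Ac; have := Ac; rewrite !inE => /andP[ca _].
  rewrite dotp_elementary_skew /v (negPf ca); congr (_ * _).
  have acA : a \in A :\ c by rewrite !inE eq_sym ca.
  rewrite (big_setD1 a) //= eqxx dotp_delta; congr (_ * _).
  rewrite /Pc; apply: eq_big => [b|b]; first by rewrite !inE andbCA.
  by rewrite !inE => /andP[/negPf ->].
have sum_j i : \sum_j \sum_(c in A)
    dotp x (v j c *m (delta_mx i j - delta_mx j i)) *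
    \prod_(b in A :\ c) dotp x (v j b) =
    (1 - n%:R) * x 0 i * P +
    \sum_(c in A :\ a) (u c 0 i * sqnorm x * Pc c - x 0 i * P).
  under eq_bigr => j _ do rewrite inner.
  rewrite big_split /=; congr (_ + _).
    rewrite -mulr_suml; congr (_ * _); rewrite sumrB sumr_const card_ord.
    rewrite (bigD1 i) //= big1 => [|j ji]; last first.
      by rewrite eq_sym (negPf ji) mul0r.
    by rewrite eqxx addr0 mulrBl -[x 0 i *+ n]mulr_natl.
  rewrite exchange_big /=; apply: eq_bigr => c Ac.
  rewrite -(PcE c) // /sqnorm !dotpE.
  transitivity (\sum_j ((u c 0 i * Pc c) * (x 0 j * x 0 j) -
                        (x 0 i * Pc c) * (x 0 j * u c 0 j))).
    by apply: eq_bigr => j _; ring.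
  by rewrite sumrB -!mulr_sumr; ring.
transitivity (\sum_i (u a 0 i * ((1 - n%:R) * x 0 i * P) +
    \sum_(c in A :\ a) u a 0 i * (u c 0 i * sqnorm x * Pc c - x 0 i * P))).
  by apply: eq_bigr => i _; rewrite sum_j mulrDr mulr_sumr.
rewrite big_split /= exchange_big /=.
have -> : \sum_i u a 0 i * ((1 - n%:R) * x 0 i * P) =
    (1 - n%:R) * \prod_(b in A) dotp x (u b).
  rewrite [in RHS](big_setD1 a) //= -/P dotpE mulrA mulr_sumr mulr_suml.
  by apply: eq_bigr => i _; ring.
have -> : \sum_(c in A :\ a) \sum_i
      u a 0 i * (u c 0 i * sqnorm x * Pc c - x 0 i * P) =
    \sum_(c in A :\ a) (sqnorm x * (dotp (u a) (u c) * Pc c)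
      - \prod_(b in A) dotp x (u b)).
  apply: eq_bigr => c _.
  transitivity (\sum_i ((sqnorm x * Pc c) * (u a 0 i * u c 0 i) -
                        P * (x 0 i * u a 0 i))).
    by apply: eq_bigr => i _; ring.
  rewrite sumrB -!mulr_sumr -!dotpE (big_setD1 a) //= -/P; ring.
have -> : #|A|%:R = 1 + #|A :\ a|%:R :> R by rewrite (cardsD1 a) Aa natrD.
by rewrite sumrB sumr_const -mulr_sumr -mulr_natl; ring.
Qed.

(* The Wick recursion: the skew-derivative identity summed over all coordinate
   planes through one of the vectors. *)
Lemma sum_prod_dotp_rec T mu (xs : seq 'rV[R]_n) (I : finType) (A : {set I})
    (u : I -> 'rV[R]_n) a :
  orthogonally_invariant T xs -> (forall x, x \in xs -> sqnorm x = mu) ->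
  (#|A| <= T)%N -> a \in A ->
  (n%:R + #|A|%:R - 2) * \sum_(x <- xs) \prod_(b in A) dotp x (u b) =
  mu * \sum_(c in A :\ a) dotp (u a) (u c) *
         \sum_(x <- xs) \prod_(b in A :\ a :\ c) dotp x (u b).
Proof.
move=> invX xs_mu AT Aa.
pose v j c : 'rV[R]_n := if c == a then delta_mx 0 j else u c.
have : \sum_(x <- xs) \sum_i u a 0 i * \sum_j \sum_(c in A)
    dotp x (v j c *m (delta_mx i j - delta_mx j i)) *
    \prod_(b in A :\ c) dotp x (v j b) = 0.
  rewrite exchange_big big1 //= => i _.
  rewrite -mulr_sumr exchange_big big1 ?mulr0 //= => j _.
  exact: (sum_skew_derivative (v j) invX AT (elementary_skew_tr i j)
            (elementary_skew_cube i j)).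
rewrite (eq_big_seq (fun x => (2 - n%:R - #|A|%:R) * \prod_(b in A) dotp x (u b)
    + mu * \sum_(c in A :\ a) dotp (u a) (u c) *
                   \prod_(b in A :\ a :\ c) dotp x (u b))); last first.
  by move=> x xxs; rewrite -(xs_mu x xxs) -sum_elementary_skew.
rewrite big_split /= -!mulr_sumr exchange_big /=.
rewrite (eq_bigr (fun c => dotp (u a) (u c) *
    \sum_(x <- xs) \prod_(b in A :\ a :\ c) dotp x (u b))) => [|c _]; last first.
  by rewrite mulr_sumr.
by move=> /eqP; rewrite addrC addr_eq0 => /eqP ->; ring.
Qed.

(** Invariance under -1 equates the sum with its own negative. *)
Lemma sum_prod_dotp_odd T (xs : seq 'rV[R]_n) (I : finType) (A : {set I})
    (u : I -> 'rV[R]_n) :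
  orthogonally_invariant T xs -> (#|A| <= T)%N -> odd #|A| ->
  \sum_(x <- xs) \prod_(b in A) dotp x (u b) = 0.
Proof.
move=> invX AT oddA.
have NN : - 1%:M *m (- 1%:M)^T = 1%:M :> 'M[R]_n.
  by rewrite linearN /= trmx1 mulmxN mulNmx opprK mulmx1.
have := invX I A u _ AT NN.
under eq_bigr => x _ do under eq_bigr => b _ do
  rewrite mulmxN mulmx1 -scaleN1r dotpZr.
under eq_bigr => x _ do rewrite big_split /= prodr_const -signr_odd oddA mulN1r.
rewrite sumrN => /eqP; rewrite eqr_oppLR -addr_eq0 -mulr2n.
by rewrite mulrn_eq0 => /eqP.
Qed.
End MomentRecursion.

(** * Sums over perfect matchings and their expansion along one point *)

Section WickSum.
Variables (R : comNzRingType) (I : finType).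

Definition pairing (A : {set I}) (P : {set {set I}}) : bool :=
  finset.partition P A && [forall B in P, #|B| == 2%N].

(** The hafnian of a weight on unordered pairs, over a ground set that can shrink. *)
Definition wick_sum (h : {set I} -> R) (A : {set I}) : R :=
  \sum_(P | pairing A P) \prod_(B in P) h B.

Lemma wick_sum0 (h : {set I} -> R) : wick_sum h finset.set0 = 1.
Proof.
rewrite /wick_sum (big_pred1 finset.set0) ?big_set0 // => P.
rewrite /pairing partition_set0; apply: andb_idr => /eqP ->.
by apply/forall_inP => B; rewrite inE.
Qed.

(** The block of [a] has two elements; the other one is [c0]. The form as an equality of predicates
    makes a sum over partners of [a] collapse to one term. *)
Lemma pairing_partner (A : {set I}) (P : {set {set I}}) a :
  pairing A P -> a \in A ->
  exists c0, forall c, (c \in A :\ a) && ([set a; c]%SET \in P) = (c == c0).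
Proof.
move=> /andP[partP /forall_inP card2] Aa.
have covP : a \in finset.cover P by rewrite (cover_partition partP).
have trivP := finset.partition_trivIset partP.
have BP := pblock_mem covP.
have aB : a \in finset.pblock P a by rewrite finset.mem_pblock.
have /cards2P[b [d [bd Bbd]]] := card2 _ BP.
have [c0 [ac0 Bac]] : exists c0, a != c0 /\ finset.pblock P a = [set a; c0]%SET.
  move: aB; rewrite Bbd !inE => /orP[] /eqP ->; first by exists d.
  by exists b; rewrite eq_sym bd finset.setUC.
exists c0 => c; apply/idP/eqP => [/andP[]|->].
  rewrite !inE => /andP[ca _] acP.
  have /(congr1 (fun B : {set I} => c \in B)) : finset.pblock P a = [set a; c]%SET.
    by apply: def_pblock => //; rewrite !inE eqxx.
  by rewrite Bac !inE eqxx orbT (negPf ca) /= => /eqP.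
rewrite -Bac BP andbT !inE eq_sym ac0 /=.
by rewrite -(cover_partition partP); apply/finset.bigcupP; exists (finset.pblock P a);
  rewrite // Bac !inE eqxx orbT.
Qed.

(** Adding the pair {a, c} is a bijection from matchings of the smaller set to matchings containing
    that pair. The second conjunct on the left excludes a [P] that already has the pair, as
    reindexing requires. *)
Lemma pairingU1 (A : {set I}) (P : {set {set I}}) a c :
  a \in A -> c \in A :\ a ->
  pairing A ([set a; c] |: P)%SET && (([set a; c] |: P) :\ [set a; c] == P)%SET
  = pairing (A :\ a :\ c) P.
Proof.
rewrite !inE => Aa /andP[ca Ac].
have AD : (A :\: [set a; c] = A :\ a :\ c)%SET.
  by apply/setP => x; rewrite !inE negb_or andbCA andbA.
have AU : ([set a; c] :|: (A :\ a :\ c) = A)%SET.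
  apply/setP => x; rewrite !inE.
  have [->|_] := eqVneq x a; first by rewrite Aa.
  by have [->|_] := eqVneq x c; first by rewrite Ac.
apply/andP/andP => [[/andP[partP card2] /eqP PE]|[partP card2]].
  rewrite -PE -AD partitionD1 ?setU11 //; split => //.
  apply/forall_inP => B /setD1P[_ BP].
  by move/forall_inP: card2; exact.
have acP : [set a; c]%SET \notin P.
  apply/negP => /(partitionS partP)/fintype.subsetP/(_ a).
  by rewrite !inE !eqxx andbF => /(_ isT).
rewrite setU1K // eqxx; split => //; apply/andP; split.
  rewrite -{1}AU partitionU1 //.
    by apply/set0Pn; exists a; rewrite !inE eqxx.
  rewrite finset.disjoints_subset; apply/fintype.subsetP => x.
  by rewrite !inE => /orP[] /eqP ->; rewrite !eqxx ?andbF.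
apply/forall_inP => B /setU1P[->|BP]; first by rewrite cards2 [a == c]eq_sym ca.
by move/forall_inP: card2; exact.
Qed.

Lemma wick_sum_rec (h : {set I} -> R) (A : {set I}) a : a \in A ->
  wick_sum h A = \sum_(c in A :\ a) h [set a; c]%SET * wick_sum h (A :\ a :\ c).
Proof.
move=> Aa; rewrite /wick_sum.
(* A sum over the partner of [a] is inserted; it has exactly one term for each matching. *)
transitivity (\sum_(P | pairing A P)
    \sum_(c | (c \in A :\ a) && ([set a; c]%SET \in P)) \prod_(B in P) h B).
  apply: eq_bigr => P pairP; have [c0 c0P] := pairing_partner pairP Aa.
  by rewrite (big_pred1 c0).
rewrite (exchange_big_dep (mem (A :\ a))) /=; last by move=> P c _ /andP[].
apply: eq_bigr => c Ac; rewrite big_distrr /=.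
rewrite (reindex_onto (fun P => [set a; c] |: P)%SET
                      (fun P => P :\ [set a; c])%SET) /=; last first.
  by move=> P /andP[_ /andP[_ ?]]; rewrite finset.setD1K.
have acP P : pairing (A :\ a :\ c) P -> [set a; c]%SET \notin P.
  move=> /andP[partP _]; apply/negP => /(partitionS partP)/fintype.subsetP/(_ a).
  by rewrite !inE !eqxx andbF => /(_ isT).
apply: eq_big => [P|P].
  by rewrite Ac setU11 !andbT pairingU1.
rewrite Ac setU11 !andbT pairingU1 // => /acP acP'.
by rewrite big_setU1.
Qed.

End WickSum.

(** * The moments of signatures as pairing sums of Gram entries *)

Section Moments.
Variables (R : realType) (n : nat) (mu : R).

(** Both sides satisfy the same recursion along a point [a]. When |A| = 2(m + 1), the coefficient n
    + |A| - 2 is the last factor n + 2m of the product. *)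
Lemma sum_prod_dotp_even T (xs : seq 'rV[R]_n) (I : finType) (u : I -> 'rV[R]_n)
    (h : {set I} -> R) (m : nat) (A : {set I}) :
  (0 < n)%N ->
  orthogonally_invariant T xs -> (forall x, x \in xs -> sqnorm x = mu) ->
  (forall a c, a != c -> h [set a; c]%SET = dotp (u a) (u c)) ->
  (#|A| <= T)%N -> #|A| = (2 * m)%N ->
  (\prod_(j < m) (n + 2 * j)%:R) * \sum_(x <- xs) \prod_(a in A) dotp x (u a)
  = (size xs)%:R * mu ^+ m * wick_sum h A.
Proof.
move=> n0 invX xs_mu hE; elim: m A => [|m IH] A AT cardA.
  have -> : A = finset.set0 by apply: cards0_eq; rewrite cardA.
  rewrite big_ord0 wick_sum0 mul1r !mulr1 (eq_bigr (fun=> 1)) => [|x _].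
    by rewrite big_const_seq count_predT iter_addr_0.
  by rewrite big_set0.
have /card_gt0P[a Aa] : (0 < #|A|)%N by rewrite cardA.
rewrite big_ord_recr /= (wick_sum_rec _ Aa) exprSr.
have := sum_prod_dotp_rec u invX xs_mu AT Aa.
have -> : n%:R + #|A|%:R - 2 = (n + 2 * m)%:R :> R.
  by rewrite cardA natrD !natrM -addn1 natrD; ring.
rewrite -mulrA => ->; rewrite mulrCA [mu ^+ m * mu]mulrC.
rewrite [_%:R * (mu * _)]mulrCA -[RHS]mulrA; congr (_ * _); rewrite !mulr_sumr.
apply: eq_bigr => c Ac; rewrite mulrCA [RHS]mulrCA.
have := Ac; rewrite !inE => /andP[ca cA].
rewrite hE 1?eq_sym //; congr (_ * _).
have cardA' : #|A :\ a :\ c| = (2 * m)%N.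
  by move: cardA; rewrite (cardsD1 a) Aa (cardsD1 c) Ac; lia.
by apply: IH => //; rewrite cardA'; move: AT; rewrite cardA; lia.
Qed.

Lemma prod_tnth_m2s r (alpha : multinom r) (F : 'I_r -> R) :
  \prod_(k < size (m2s alpha)) F (tnth (in_tuple (m2s alpha)) k) =
  \prod_(i < r) F i ^+ alpha i.
Proof.
rewrite -(big_tnth _ _ _ predT F) /m2s big_flatten big_map big_enum /=.
by apply: eq_bigr => i _; rewrite big_nseq -Monoid.iteropE.
Qed.

(** Passes from ordered pairs a < b to unordered blocks, the symmetry of [H] making the weight
    independent of the order. On a block of two elements the product defining [h] has a single
    factor. *)
Lemma pairing_sum_wick r (H : 'M[R]_r) (l : seq 'I_r) : H^T = H ->
  exists2 h : {set 'I_(size l)} -> R,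
    (forall a c, a != c -> h [set a; c]%SET =
       H (tnth (in_tuple l) a) (tnth (in_tuple l) c)) &
    pairing_sum H l = wick_sum h finset.setT.
Proof.
move=> HT; have HC i j : H i j = H j i by rewrite -{1}HT mxE.
pose F (ab : 'I_(size l) * 'I_(size l)) : R :=
  H (tnth (in_tuple l) ab.1) (tnth (in_tuple l) ab.2).
pose h (B : {set 'I_(size l)}) :=
  \prod_(ab : 'I_(size l) * 'I_(size l)
         | (ab.1 < ab.2)%N && ([set ab.1; ab.2]%SET == B)) F ab.
have h_lt (a c : 'I_(size l)) : (a < c)%N -> h [set a; c]%SET = F (a, c).
  move=> ac; rewrite /h (big_pred1 (a, c)) // => -[b d] /=.
  apply/andP/eqP => [[bd /eqP E]|[-> ->]]; last by rewrite ac eqxx.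
  have : b \in [set a; c]%SET by rewrite -E !inE eqxx.
  have : d \in [set a; c]%SET by rewrite -E !inE eqxx orbT.
  rewrite !inE => /orP[] /eqP dE /orP[] /eqP bE; move: bd; rewrite dE bE ?ltnn //.
  by rewrite ltnNge ltnW.
exists h.
  move=> a c; rewrite neq_ltn => /orP[/h_lt //|ca].
  by rewrite finset.setUC h_lt // /F HC.
apply: eq_bigr => P _.
rewrite (partition_big (fun ab => [set ab.1; ab.2]%SET) (mem P)) /=; last first.
  by move=> ab /andP[].
apply: eq_bigr => B BP; apply: eq_bigl => ab; rewrite -andbA; congr andb.
by apply: andb_idl => /eqP ->.
Qed.

(* C is arbitrary: the rows of g *m B, for g in Gamma, need not lie in L. *)
Lemma moment_signature T (xs : seq 'rV[R]_n) r (C : 'M[R]_(r, n))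
    (alpha : multinom r) :
  (0 < n)%N ->
  orthogonally_invariant T xs -> (forall x, x \in xs -> sqnorm x = mu) ->
  (mdeg alpha <= T)%N ->
  \sum_(x <- xs) monomial alpha (signature C x) =
  moment n (size xs) mu (gram C) alpha.
Proof.
move=> n0 invX xs_mu alphaT.
pose l := m2s alpha; pose u k := row (tnth (in_tuple l) k) C.
have sumE : \sum_(x <- xs) monomial alpha (signature C x) =
    \sum_(x <- xs) \prod_(k in [set: 'I_(size l)]%SET) dotp x (u k).
  apply: eq_bigr => x _; rewrite /monomial -prod_tnth_m2s.
  by apply: eq_big => k; rewrite ?inE // mxE.
have card_l : #|[set: 'I_(size l)]%SET| = mdeg alpha.
  by rewrite cardsT card_ord size_m2s.
rewrite /moment sumE; case: ifPn => [odd_alpha|even_alpha].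
  by apply: (sum_prod_dotp_odd _ invX); rewrite card_l.
have gramT : (gram C)^T = gram C.
  by apply/matrixP => i j; rewrite !mxE dotpC.
have [h hE ->] := pairing_sum_wick l gramT.
(* Positivity of [n] covers the factor j = 0. *)
have den0 : \prod_(j < (mdeg alpha)./2) (n + 2 * j)%:R != 0 :> R.
  by apply/prodf_neq0 => j _; rewrite pnatr_eq0 -lt0n addn_gt0 n0.
apply: (mulfI den0).
rewrite (sum_prod_dotp_even (u := u) (h := h) n0 invX xs_mu) ?card_l //.
- by rewrite [RHS]mulrA [X in _ = X * _]mulrCA divff // mulr1.
- by move=> a c /hE ->; rewrite mxE.
- by rewrite mul2n even_halfK.
Qed.
End Moments.

(** * Where signatures of minimal vectors lie, and how often those in E occur *)

Section LatticeSignatures.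
Variables (R : realType) (n r : nat) (L : set 'rV[R]_n) (mu : R).
Variable B : 'M[R]_(r, n).

Definition int_comb (z : 'cV[int]_r) : 'rV[R]_n := (int_vec R z)^T *m B.

Lemma gramE : gram B = B *m B^T.
Proof.
apply/matrixP => i j; rewrite !mxE dotpE.
by apply: eq_bigr => k _; rewrite !mxE.
Qed.

Lemma signatureE x : signature B x = B *m x^T.
Proof.
apply/matrixP => i j; rewrite !mxE dotpE.
by apply: eq_bigr => k _; rewrite !mxE ord1 mulrC.
Qed.

Lemma gram_tr : (gram B)^T = gram B.
Proof. by rewrite gramE trmx_mul trmxK. Qed.

Lemma gram_int_vec z : gram B *m int_vec R z = signature B (int_comb z).
Proof. by rewrite signatureE gramE /int_comb trmx_mul trmxK mulmxA. Qed.

Lemma qform_gram z : qform (gram B) (int_vec R z) = sqnorm (int_comb z).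
Proof.
by rewrite /qform /sqnorm /dotp gramE /int_comb trmx_mul trmxK !mulmxA.
Qed.

Lemma dotp_int_comb z x :
  ((int_vec R z)^T *m signature B x) 0 0 = dotp x (int_comb z).
Proof. by rewrite dotpC /dotp signatureE mulmxA. Qed.

Lemma sqnorm_ge0 (x : 'rV[R]_n) : 0 <= sqnorm x.
Proof.
by rewrite /sqnorm dotpE sumr_ge0 // => i _; rewrite -expr2 sqr_ge0.
Qed.

Lemma sqnorm_eq0 (x : 'rV[R]_n) : sqnorm x = 0 -> x = 0.
Proof.
rewrite /sqnorm dotpE => /eqP; rewrite psumr_eq0 => [/allP x0|i _]; last first.
  by rewrite -expr2 sqr_ge0.
apply/rowP => i; have := x0 i (mem_index_enum i).
by rewrite mulf_eq0 orbb mxE => /eqP.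
Qed.

Lemma sqnormD (x y : 'rV[R]_n) :
  sqnorm (x + y) = sqnorm x + 2 * dotp x y + sqnorm y.
Proof.
have DD u : dotp (x + y) u = dotp x u + dotp y u.
  by rewrite dotpC dotpDr dotpC [dotp u y]dotpC.
by rewrite /sqnorm DD !dotpDr [dotp y x]dotpC; ring.
Qed.

Lemma sqnormN (x : 'rV[R]_n) : sqnorm (- x) = sqnorm x.
Proof. by rewrite /sqnorm /dotp linearN /= mulNmx mulmxN opprK. Qed.

Lemma dotpNr (x y : 'rV[R]_n) : dotp x (- y) = - dotp x y.
Proof. by rewrite -scaleN1r dotpZr mulN1r. Qed.

Lemma sqnormB (x y : 'rV[R]_n) :
  sqnorm (x - y) = sqnorm x - 2 * dotp x y + sqnorm y.
Proof. by rewrite sqnormD sqnormN dotpNr mulrN. Qed.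

(** If w H = 0 then w B has squared norm 0, hence w = 0 by row freeness. *)
Lemma gram_unit : row_free B -> gram B \in unitmx.
Proof.
move=> freeB; rewrite -row_free_unit -kermx_eq0.
apply/rowV0P => w /sub_kermxP wH; apply/eqP.
rewrite -(mulmx_free_eq0 _ freeB); apply/eqP/sqnorm_eq0.
by rewrite /sqnorm /dotp trmx_mul mulmxA -[w *m B *m B^T]mulmxA -gramE wH mul0mx mxE.
Qed.

(* The form q applied to y(x) is the squared norm of the orthogonal projection
   of x to the span of the b_i. *)
Lemma qform_signature_le x :
  row_free B -> qform (invmx (gram B)) (signature B x) <= sqnorm x.
Proof.
move=> freeB; have uH := gram_unit freeB.
pose p := x *m B^T *m invmx (gram B) *m B.
have qE : qform (invmx (gram B)) (signature B x) = dotp p x.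
  by rewrite /qform /dotp signatureE trmx_mul trmxK !mulmxA.
have pp : sqnorm p = dotp p x.
  rewrite /sqnorm /dotp {2}/p !trmx_mul trmxK trmx_inv gram_tr !mulmxA.
  congr (fun_of_matrix _ 0 0); rewrite {1}/p -[_ *m B *m B^T]mulmxA -gramE.
  by rewrite mulmxKV // /p !mulmxA.
have := sqnorm_ge0 (x - p); rewrite sqnormB pp [dotp x p]dotpC -qE; lra.
Qed.

Lemma int_combN z : int_comb (- z) = - int_comb z.
Proof. by rewrite /int_comb /int_vec map_mxN linearN mulNmx. Qed.

Hypothesis L_integral : integral_lattice L.
Hypothesis B_in_L : forall i, L (row i B).
Hypothesis L_min : min_sqnorm L mu.
Hypothesis B_free : row_free B.

Lemma lattice_int_comb z : L (int_comb z).
Proof.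
have [[k [C [_ LE]]] _] := L_integral.
have /choice[w wB] : forall i, exists w : 'rV[int]_k, map_mx intr w *m C = row i B.
  by move=> i; have := B_in_L i; rewrite LE => -[w _ <-]; exists w.
rewrite LE; exists (z^T *m \matrix_i w i) => //.
rewrite /int_comb /int_vec map_mxM map_trmx -mulmxA; congr (_ *m _).
by apply/row_matrixP => i; rewrite row_mul -wB -map_row rowK.
Qed.

Lemma lattice_sub u v : L u -> L v -> L (u - v).
Proof.
have [[k [C [_ ->]]] _] := L_integral.
move=> [a _ <-] [b _ <-]; exists (a - b) => //.
by rewrite map_mxB mulmxBl.
Qed.

Lemma min_sqnorm_gt0 : 0 < mu.
Proof.
have [[v _ [v0 <-]] _] := L_min; rewrite lt0r sqnorm_ge0 andbT.
by apply: contra v0 => /eqP/sqnorm_eq0 ->.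
Qed.

Lemma signature_integral x : L x -> exists w, signature B x = int_vec R w.
Proof.
move=> Lx; exists (\col_i Num.floor (dotp x (row i B))).
apply/colP => i; rewrite !mxE; apply/esym/eqP.
by rewrite -intrEfloor; case: L_integral => _; apply.
Qed.

(** The nonzero lattice vector v - x has squared norm at least mu, the squared norm of x; the bound
    follows by expansion. *)
Lemma shell_dotp_le x v : shell L mu x -> L v -> v != x ->
  dotp x v <= sqnorm v / 2.
Proof.
move=> [Lx xmu] Lv vx; have [_ minL] := L_min.
have := minL _ (lattice_sub Lv Lx); rewrite subr_eq0 => /(_ vx).
rewrite sqnormB xmu [dotp v x]dotpC; lra.
Qed.

Variable Z : set 'cV[int]_r.
Hypothesis Z_antipodal : antipodal Z.

Let H := gram B.

(** H z is the signature of the combination with coefficients z, and z^t H z is the squared norm of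
    that combination. *)
Lemma sig_E_int_comb e : sig_E H mu Z e ->
  exists z, [/\ Z z, shell L mu (int_comb z) & e = signature B (int_comb z)].
Proof.
move=> [z [Zz zmu] <-]; exists z; split => //; last exact: gram_int_vec.
by split; [exact: lattice_int_comb|rewrite -qform_gram].
Qed.

(** The inner product of x with a combination of the b_i depends only on the signature of x. Here it
    equals mu, so the difference of the two vectors has squared norm 0. *)
Lemma signature_int_comb_inj x z : shell L mu x -> shell L mu (int_comb z) ->
  signature B x = signature B (int_comb z) -> x = int_comb z.
Proof.
move=> [_ xmu] [_ zmu] xz; apply/eqP; rewrite -subr_eq0; apply/eqP/sqnorm_eq0.
rewrite sqnormB -dotp_int_comb xz dotp_int_comb xmu -/(sqnorm _) zmu; ring.
Qed.

(** At y = H z the condition of D for this same z reads mu <= mu / 2, contrary to mu > 0. *)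
Lemma sig_DE_disjoint : sig_D H mu Z `&` sig_E H mu Z = set0.
Proof.
apply/seteqP; split => // y [[_ _ yD] /sig_E_int_comb[z [Zz [_ zmu] yE]]].
have := yD z Zz; rewrite yE dotp_int_comb qform_gram -/(sqnorm _) zmu.
by have mu0 := min_sqnorm_gt0; rewrite (ger0_norm (ltW mu0)) => ?; exfalso; lra.
Qed.

Lemma signature_in_DE x :
  shell L mu x -> (sig_D H mu Z `|` sig_E H mu Z) (signature B x).
Proof.
move=> Xx; have [Lx xmu] := Xx.
have [[z Zz xz]|noz] := pselect (exists2 z, Z z & int_comb z = x).
  right; exists z; last by rewrite gram_int_vec xz.
  by split => //; rewrite qform_gram xz.
left; split.
- exact: signature_integral.
- by rewrite -xmu; exact: qform_signature_le.
- move=> z Zz; rewrite dotp_int_comb qform_gram ler_norml; apply/andP; split.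
    (* The lower bound is the upper bound for -z; antipodality rules out that x is the combination
       given by -z. *)
    have := shell_dotp_le Xx (lattice_int_comb (- z)).
    rewrite int_combN sqnormN dotpNr => /(_ _); rewrite lerNl; apply.
    apply/eqP => zx; apply: noz; exists (- z); first exact: Z_antipodal.
    by rewrite int_combN.
  apply: shell_dotp_le => //; first exact: lattice_int_comb.
  by apply/eqP => zx; apply: noz; exists z.
Qed.

Lemma sig_E_count e : sig_E H mu Z e -> signature_count (shell L mu) B e = 1%N.
Proof.
move=> /sig_E_int_comb[z [_ zX ->]]; rewrite /signature_count.
rewrite [X in fset_set X](_ : _ = [set int_comb z]).
  by rewrite fset_set1 cardfs1.
apply/seteqP; split => [x [Xx]|_ ->]; last by [].
exact: signature_int_comb_inj.
Qed.

(** Serves to rewrite the part of a sum over X with signature in E as a sum over E. *)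
Lemma signature_bij_E :
  set_bij (shell L mu `&` [set x | sig_E H mu Z (signature B x)])
    (sig_E H mu Z) (signature B).
Proof.
split.
- by move=> x [].
- move=> x y /set_mem[Xx /sig_E_int_comb[z [_ zX xz]]] /set_mem[Xy _] xy.
  rewrite (signature_int_comb_inj Xx zX xz).
  by rewrite (signature_int_comb_inj Xy zX) // -xy.
- move=> e Ee; have [z [_ zX eE]] := sig_E_int_comb Ee.
  by exists (int_comb z); rewrite -?eE //; split => //=; rewrite -eE.
Qed.

End LatticeSignatures.

(** * Group averages versus orbit sums, and invariance of the Gram matrix *)

Section OrbitAverage.
Variables (R : realType) (r : nat) (G : set 'M[R]_r).
Hypothesis G_group : finite_linear_group G.

Lemma orbit_image (g : 'M[R]_r) (y : 'cV[R]_r) : G g ->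
  set_bij [set k *m y | k in G] [set k *m y | k in G] (mulmx g).
Proof.
have [_ _ GM GV] := G_group => Gg; have [ug Gg'] := GV g Gg; split.
- by move=> _ [k Gk <-]; exists (g *m k); rewrite ?mulmxA //; exact: GM.
- by move=> u v _ _ /(can_inj (mulKmx ug)).
- move=> _ [k Gk <-]; exists (invmx g *m (k *m y)); last by rewrite mulKVmx.
  by exists (invmx g *m k); rewrite ?mulmxA //; exact: GM.
Qed.

Lemma group_right_mul (k : 'M[R]_r) : G k -> set_bij G G (fun g : 'M[R]_r => g *m k).
Proof.
have [_ _ GM GV] := G_group => Gk; have [uk Gk'] := GV k Gk; split.
- by move=> g Gg; exact: GM.
- by move=> u v _ _ /(can_inj (mulmxK uk)).
- by move=> g Gg; exists (g *m invmx k); rewrite /= ?mulmxKV //; exact: GM.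
Qed.

(** Double counting of h (g v) over g in G and v in O: for fixed v = k y, right translation by k
    permutes G; for fixed g, multiplication by g permutes O. This replaces a count of
    stabilizers. *)
Lemma orbit_sum (h : 'cV[R]_r -> R) (y : 'cV[R]_r) :
  let O := [set g *m y | g in G] in
  (\sum_(v \in O) (1 : R)) * \sum_(g \in G) h (g *m y) =
  (\sum_(g \in G) (1 : R)) * \sum_(v \in O) h v.
Proof.
move=> O; have [finG G1 _ _] := G_group.
have finO : finite_set O by exact: finite_image.
transitivity (\sum_(v \in O) \sum_(g \in G) h (g *m v)).
  rewrite mulr_fsuml; apply: eq_fsbigr => v /set_mem[k Gk <-].
  rewrite mul1r (reindex_fsbig (fun g : 'M[R]_r => g *m k) G G) /=;
    last exact: group_right_mul.
  by apply: eq_fsbigr => g _; rewrite mulmxA.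
rewrite exchange_fsbig // mulr_fsuml; apply: eq_fsbigr => g /set_mem Gg.
rewrite mul1r [RHS](reindex_fsbig (fun v : 'cV[R]_r => g *m v) O O) //.
exact: orbit_image.
Qed.

Lemma fsum1_gt0 (T : choiceType) (A : set T) a :
  finite_set A -> A a -> 0 < \sum_(x \in A) (1 : R).
Proof.
move=> finA Aa; rewrite (fsbigD1 a) // ltr_wpDr //.
by apply: fsumr_ge0.
Qed.

Lemma orbit_sum_ge0 (h : 'cV[R]_r -> R) (y : 'cV[R]_r) :
  0 <= \sum_(v \in [set g *m y | g in G]) h v -> 0 <= \sum_(g \in G) h (g *m y).
Proof.
have [finG G1 _ _] := G_group => h0.
have O0 : 0 < \sum_(v \in [set g *m y | g in G]) (1 : R).
  by apply: (@fsum1_gt0 _ _ y); [exact: finite_image|exists 1%:M; rewrite ?mul1mx].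
rewrite -(pmulr_rge0 _ O0) orbit_sum mulr_ge0 // ltW //.
exact: (@fsum1_gt0 _ _ 1%:M).
Qed.

(** By polarization, a symmetric matrix whose quadratic form vanishes is zero; this is applied to
    the difference [D] of the two sides. *)
Lemma preserves_form_congruence (M : 'M[R]_r) : M^T = M ->
  preserves_form G (qform M) -> forall g, G g -> g^T *m M *m g = M.
Proof.
move=> MT Gq g Gg; apply/eqP; rewrite -subr_eq0; apply/eqP.
set D := _ - M.
have DT : D^T = D by rewrite /D linearB /= !trmx_mul trmxK MT mulmxA.
have D0 y : qform D y = 0.
  apply/eqP; rewrite -(subrr (qform M y)) -{1}(Gq g Gg y) /qform /D trmx_mul.
  by rewrite mulmxBr mulmxBl !mulmxA !mxE.
move: DT D0; move: D => D DT D0.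
have DE i j : D i j = ((delta_mx 0 i : 'rV[R]_r) *m D *m (delta_mx j 0 : 'cV[R]_r)) 0 0.
  by rewrite -rowE -colE !mxE.
have D00 i : D i i = 0 by rewrite DE -trmx_delta; exact: D0.
have DC i j : D i j = D j i by rewrite -{1}DT mxE.
apply/matrixP => i j; rewrite mxE; apply: (mulfI (_ : 2 != 0 :> R)).
  by rewrite pnatr_eq0.
have := D0 (delta_mx i 0 + delta_mx j 0).
rewrite /qform [(_ + _)^T]linearD /= !trmx_delta !mulmxDl !mulmxDr.
rewrite ![fun_of_matrix (_ + _) _ _]mxE -!DE !D00 [D j i]DC add0r addr0 mulr0 => <-; ring.
Qed.

(** Invariance of q says g^t H^-1 g = H^-1; inverting this gives g H g^t = H, whose left side is the
    Gram matrix of the rows of [g *m B]. *)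
Lemma gram_invariant n (B : 'M[R]_(r, n)) : row_free B ->
  preserves_form G (qform (invmx (gram B))) ->
  forall g, G g -> gram (g *m B) = gram B.
Proof.
move=> freeB Gq g Gg; have uH := gram_unit freeB.
have [_ _ _ GV] := G_group; have [ug _] := GV g Gg.
have Hg : g^T *m invmx (gram B) *m g = invmx (gram B).
  by apply: preserves_form_congruence => //; rewrite trmx_inv gram_tr.
have uK : g^T *m invmx (gram B) \in unitmx.
  by rewrite unitmx_mul unitmx_tr ug unitmx_inv.
apply: (can_inj (mulKmx uK)).
rewrite mulmxKV // [gram (g *m B)]gramE trmx_mul !mulmxA.
by rewrite -[_ *m g *m B *m B^T]mulmxA -gramE Hg mulVmx // mul1mx.
Qed.
End OrbitAverage.

(** * Linear programming duality on orbits, with the moments as given data *)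

Section OrbitDuality.
Variables (R : realType) (n r k : nat) (mu : R) (X : set 'rV[R]_n).
Variables (B : 'M[R]_(r, n)) (D E : set 'cV[R]_r) (G : set 'M[R]_r).
Variables (M : multinom r -> R) (psi : 'cV[R]_r -> R).
Variables (S : {set bmultinom r k}) (lambda : bmultinom r k -> R).
Hypothesis X_finite : finite_set X.
Hypothesis E_finite : finite_set E.
Hypothesis X_signature : forall x, X x -> (D `|` E) (signature B x).
Hypothesis X_bij_E :
  set_bij (X `&` [set x | E (signature B x)]) E (signature B).
Hypothesis G_group : finite_linear_group G.
Hypothesis G_preserves_E : preserves_set G E.
Hypothesis psi_invariant : invariant_on G (D `|` E) psi.
Hypothesis G_moments : forall g (alpha : bmultinom r k), G g ->
  \sum_(x \in X) monomial alpha (g *m signature B x) = M alpha.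

Let XD : set 'rV[R]_n := X `&` ~` [set x | E (signature B x)].

(** The dual polynomial, to be compared with [psi] orbit by orbit. *)
Let Lambda (y : 'cV[R]_r) : R := \sum_(alpha in S) lambda alpha * monomial alpha y.

Let dual_value : R :=
  \sum_(alpha in S) lambda alpha * (M alpha - \sum_(e \in E) monomial alpha e).

Lemma sum_signature_split (F : 'cV[R]_r -> R) :
  \sum_(x \in X) F (signature B x) =
  \sum_(e \in E) F e + \sum_(x \in XD) F (signature B x).
Proof.
rewrite (fsbigID [set x | E (signature B x)]) //=; congr (_ + _).
by rewrite (reindex_fsbig (signature B) _ E _ X_bij_E).
Qed.

Lemma sum_E_invariant (F : 'cV[R]_r -> R) g : G g ->
  \sum_(e \in E) F (g *m e) = \sum_(e \in E) F e.
Proof.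
move=> Gg; rewrite -{2}(G_preserves_E Gg) fsbig_image // => u v _ _.
have [_ _ _ GV] := G_group; have [ug _] := GV g Gg.
exact: (can_inj (mulKmx ug)).
Qed.

Lemma fsum_Lambda (T : choiceType) (A : set T) (y : T -> 'cV[R]_r) :
  finite_set A ->
  \sum_(t \in A) Lambda (y t) =
  \sum_(alpha in S) lambda alpha * \sum_(t \in A) monomial alpha (y t).
Proof.
move=> finA; rewrite fsbig_finite // /Lambda exchange_big /=.
by apply: eq_bigr => alpha _; rewrite fsbig_finite // mulr_sumr.
Qed.

(** The sum over all of X is fixed by the moments for every g, and g permutes E, so the remaining
    part is independent of g. *)
Lemma sum_XD_Lambda g : G g ->
  \sum_(x \in XD) Lambda (g *m signature B x) = dual_value.
Proof.
move=> Gg; have := sum_signature_split (fun y => Lambda (g *m y)).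
rewrite (sum_E_invariant Lambda Gg) => /eqP; rewrite addrC -subr_eq => /eqP <-.
rewrite !fsum_Lambda // -sumrB; apply: eq_bigr => alpha _.
by rewrite -mulrBr G_moments.
Qed.

(* Only averages over G are controlled: the number of x in X with y(x) = y is
   not assumed constant on the G-orbits of D. *)
Lemma orbit_average_gap :
  (\sum_(g \in G) (1 : R)) *
    (\sum_(x \in X) psi (signature B x) -
      (\sum_(e \in E) psi e + dual_value)) =
  \sum_(x \in XD) \sum_(g \in G)
    (psi (g *m signature B x) - Lambda (g *m signature B x)).
Proof.
have [finG _ _ _] := G_group.
have finXD : finite_set XD by exact: finite_setIl.
rewrite exchange_fsbig // mulr_fsuml; apply: eq_fsbigr => g /set_mem Gg.
rewrite mul1r fsbig_finite // sumrB -!fsbig_finite // sum_XD_Lambda //.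
rewrite (sum_signature_split psi) opprD addrA [X in X - _]addrAC subrr add0r.
congr (_ - _); apply: eq_fsbigr => x /set_mem[Xx _].
by rewrite psi_invariant //; exact: X_signature.
Qed.

Lemma orbit_sum_gap O : orbits G D O ->
  \sum_(y \in O) (psi y - Lambda y) =
  \sum_(y \in O) psi y -
    \sum_(alpha in S) (\sum_(y \in O) monomial alpha y) * lambda alpha.
Proof.
have [finG _ _ _] := G_group; move=> [y _ <-].
have finO : finite_set [set g *m y | g in G] by exact: finite_image.
rewrite fsbig_finite // sumrB -!fsbig_finite // fsum_Lambda //.
by congr (_ - _); apply: eq_bigr => alpha _; rewrite mulrC.
Qed.

Lemma XD_orbit x : XD x -> orbits G D [set g *m signature B x | g in G].
Proof.
by move=> [Xx nEx]; have [Dx|//] := X_signature Xx; exists (signature B x).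
Qed.

(** |G| times the gap is a sum of group averages at signatures in D, each a positive multiple of an
    orbit sum of [psi - Lambda], which dual feasibility makes nonnegative. *)
Lemma orbit_duality_ge :
  (forall O, orbits G D O ->
    \sum_(alpha in S) (\sum_(y \in O) monomial alpha y) * lambda alpha
      <= \sum_(y \in O) psi y) ->
  \sum_(e \in E) psi e + dual_value <= \sum_(x \in X) psi (signature B x).
Proof.
have [finG G1 _ _] := G_group => le_c.
rewrite -subr_ge0 -(pmulr_rge0 _ (fsum1_gt0 R finG G1)) orbit_average_gap.
apply: fsumr_ge0 => x XDx.
apply: (orbit_sum_ge0 G_group (h := fun y => psi y - Lambda y)).
by rewrite orbit_sum_gap ?subr_ge0; [apply: le_c|]; exact: XD_orbit.
Qed.

Lemma orbit_duality_eq :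
  (forall O, orbits G D O ->
    \sum_(alpha in S) (\sum_(y \in O) monomial alpha y) * lambda alpha
      = \sum_(y \in O) psi y) ->
  \sum_(x \in X) psi (signature B x) = \sum_(e \in E) psi e + dual_value.
Proof.
have [finG G1 _ _] := G_group => eq_c; apply/eqP; rewrite -subr_eq0.
have /lt0r_neq0 := fsum1_gt0 R finG G1; move=> /mulfI/inj_eq <-.
rewrite mulr0 orbit_average_gap fsbig1 // => x XDx.
have OD := XD_orbit XDx.
have /lt0r_neq0 O0 : 0 < \sum_(v \in [set g *m signature B x | g in G]) (1 : R).
  apply: (@fsum1_gt0 _ _ _ (signature B x)); first exact: finite_image.
  by exists 1%:M; rewrite ?mul1mx.
apply: (mulfI O0).
rewrite (orbit_sum G_group (fun y => psi y - Lambda y)).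
by rewrite orbit_sum_gap // eq_c // subrr !mulr0.
Qed.

End OrbitDuality.

(** * The bound for the minimal shell of an integral lattice *)

Lemma spherical_design_invariant (R : realType) n T mu (X : set 'rV[R]_n) :
  spherical_design T mu X -> X !=set0 -> orthogonally_invariant T (fset_set X).
Proof.
move=> X_design X0 I A u Q AT QQ; have [finX _ _] := X_design.
rewrite -!fsbig_finite //.
exact: spherical_design_orthogonal_invariant X_design X0 AT QQ.
Qed.

Theorem proposition9p2 (R : realType) (n s r N : nat)
    (L : set 'rV[R]_n) (mu : R) (B : 'M[R]_(r, n)) (Z : set 'cV[int]_r)
    (L_integral : integral_lattice L)
    (L_min : min_sqnorm L mu)
    (X_card : (shell L mu #= `I_N)%card)
    (X_design : spherical_design (2 * s + 1) mu (shell L mu))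
    (B_in_L : forall i, L (row i B))
    (B_free : row_free B)
    (Z_finite : finite_set Z)
    (Z_antipodal : antipodal Z)
    (Z_nonzero : ~ Z 0) :
  let X := shell L mu in
  let H := gram B in
  let D := sig_D H mu Z in
  let E := sig_E H mu Z in
  [/\ D `&` E = set0,
      forall x, X x -> (D `|` E) (signature B x),
      forall e, E e -> signature_count X B e = 1%N &
      forall (G : set 'M[R]_r) (psi : 'cV[R]_r -> R)
             (S : {set bmultinom r (2 * s + 2)})
             (lambda : bmultinom r (2 * s + 2) -> R),
        finite_linear_group G ->
        preserves_form G (qform (invmx H)) ->
        preserves_set G D ->
        preserves_set G E ->
        invariant_on G (D `|` E) psi ->
        let A alpha (O : set 'cV[R]_r) := \sum_(y \in O) monomial alpha y in
        let b alpha := moment n N mu H alpha - \sum_(e \in E) monomial alpha e in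
        let c (O : set 'cV[R]_r) := \sum_(y \in O) psi y in
        ((forall O, orbits G D O ->
            \sum_(alpha in S) A alpha O * lambda alpha <= c O) ->
         \sum_(x \in X) psi (signature B x)
           >= \sum_(e \in E) psi e + \sum_(alpha in S) lambda alpha * b alpha)
        /\
        ((forall O, orbits G D O ->
            \sum_(alpha in S) A alpha O * lambda alpha = c O) ->
         \sum_(x \in X) psi (signature B x)
           = \sum_(e \in E) psi e + \sum_(alpha in S) lambda alpha * b alpha)].
Proof.
move=> X H D E.
have E_signature e : E e -> signature_count X B e = 1%N.
  exact: (sig_E_count L_integral B_in_L).
split => //.
- exact: (sig_DE_disjoint L_integral B_in_L L_min).
- by move=> x Xx; exact: (signature_in_DE L_integral B_in_L L_min).
move=> G psi S lambda G_group G_form G_D G_E psi_inv A b c.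
have [finX _ _] := X_design.
have [v Lv [v0 vmu]] := proj1 L_min.
have X0 : X !=set0 by exists v.
have n0 : (0 < n)%N.
  by rewrite lt0n; apply: contra_neq v0 => n0; subst n; rewrite [v]thinmx0.
have sizeX : size (fset_set X) = N by exact: card_fset_set.
have finE : finite_set E.
  by apply: finite_image; apply: sub_finite_set Z_finite => z [].
have bijE := @signature_bij_E _ _ _ _ mu _ L_integral B_in_L Z.
have moments g (alpha : bmultinom r (2 * s + 2)) : G g ->
    \sum_(x \in X) monomial alpha (g *m signature B x) = moment n N mu H alpha.
  (* g y(x) is the signature of x against the rows of [g *m B], which have Gram matrix H again. *)
  move=> Gg; rewrite /H -(gram_invariant G_group B_free G_form Gg) -sizeX.
  rewrite -(moment_signature _ n0 (spherical_design_invariant X_design X0)).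
  - rewrite fsbig_finite //; apply: eq_bigr => x _.
    by rewrite !signatureE mulmxA.
  - by move=> x; rewrite in_fset_set // => /set_mem[].
  (* Elements of [bmultinom r (2 * s + 2)] have degree strictly below 2s + 2, that is, at most the
     design strength 2s + 1. *)
  - by rewrite -ltnS -addnS; exact: bmdeg.
split.
- apply: (orbit_duality_ge finX finE _ bijE G_group G_E psi_inv moments).
  by move=> x Xx; exact: (signature_in_DE L_integral B_in_L L_min).
- apply: (orbit_duality_eq finX finE _ bijE G_group G_E psi_inv moments).
  by move=> x Xx; exact: (signature_in_DE L_integral B_in_L L_min).
Qed.
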